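(* The category $\mathbf{BPOL}_\bullet$ is isomorphic to the category $\mathbf{P}^2_\bullet$.
   Context: A p-site is a triple $\mathbf{a}=(I,A,(A_i)_{i\in I})$ with $I$ a finite set (the base), $A$ a set (the ground), and $A_i\subset A$ for each $i\in I$. For a function $\varphi:I\to J$, $\hat\varphi:\mathcal{P}(I)\to\mathcal{P}(J)$ is $\hat\varphi(s)=\{\varphi(i):i\in s\}$. Given p-sites $\mathbf{a}=(I,A,(A_i))$ and $\mathbf{b}=(J,B,(B_j))$, a B-map $\mathbf{a}\to\mathbf{b}$ is a pair $(\varphi,f)$ of functions $\varphi:I\to J$, $f:A\to B$ with $\bigcup_{i\in\varphi^{-1}(j)}A_i=f^{-1}(B_j)$ for all $j\in J$. When $I=J$, a BG-map $\mathbf{a}\to\mathbf{b}$ is a function $f:A\to B$ with $A_i=f^{-1}(B_i)$ for all $i\in I$. Let $\mathbf{bpol}_{\bullet/b}(\mathbf{a},\mathbf{b})$ be the set of functions $\varphi:I\to J$ for which there exists $f:A\to B$ such that $(\varphi,f)$ is a B-map $\mathbf{a}\to\mathbf{b}$. Write $\mathbf{a}\sim_B\mathbf{a}'$ if $\mathbf{a}$ and $\mathbf{a}'$ have the same base and there exist a BG-map $\mathbf{a}\to\mathbf{a}'$ and a BG-map $\mathbf{a}'\to\mathbf{a}$; this is an equivalence relation on p-sites, and $\mathbf{bpol}_{\bullet/b}(\mathbf{a},\mathbf{b})=\mathbf{bpol}_{\bullet/b}(\mathbf{a}',\mathbf{b}')$ whenever $\mathbf{a}\sim_B\mathbf{a}'$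 and $\mathbf{b}\sim_B\mathbf{b}'$. Category $\mathbf{BPOL}_\bullet$: objects are the $\sim_B$-equivalence classes $\dot{\mathbf{a}}$ of p-sites; morphisms are $\mathbf{BPOL}_\bullet(\dot{\mathbf{a}},\dot{\mathbf{b}})=\mathbf{bpol}_{\bullet/b}(\mathbf{a},\mathbf{b})$, with composition of functions and identity $id_I$. Category $\mathbf{P}^2_\bullet$: objects are pairs $(I,\mathcal{X})$ with $I$ a finite set and $\mathcal{X}\subset\mathcal{P}(I)$; a morphism $(I,\mathcal{X})\to(J,\mathcal{Y})$ is a function $\varphi:I\to J$ with $\hat\varphi(s)\in\mathcal{Y}$ for all $s\in\mathcal{X}$; composition is composition of functions. *)

(* Defs.v *)
From mathcomp Require Import all_boot all_classical.

Set Implicit Arguments.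
Unset Strict Implicit.
Unset Printing Implicit Defensive.

Local Open Scope classical_set_scope.

Record category := Category {
  obj :> Type;
  hom : obj -> obj -> Type;
  idm : forall X, hom X X;
  comp : forall X Y Z, hom Y Z -> hom X Y -> hom X Z;
  comp1m : forall X Y (u : hom X Y), comp (idm Y) u = u;
  compm1 : forall X Y (u : hom X Y), comp u (idm X) = u;
  compA : forall X Y Z T (w : hom Z T) (v : hom Y Z) (u : hom X Y),
    comp w (comp v u) = comp (comp w v) u }.

Record functor (C D : category) := Functor {
  fobj :> C -> D;
  fmap : forall X Y, hom X Y -> hom (fobj X) (fobj Y);
  fmap_id : forall X, fmap (idm X) = idm (fobj X);
  fmap_comp : forall X Y Z (v : hom Y Z) (u : hom X Y),
    fmap (comp v u) = comp (fmap v) (fmap u) }.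

Definition functor_id (C : category) : functor C C :=
  @Functor C C id (fun _ _ u => u) (fun _ => erefl) (fun _ _ _ _ _ => erefl).

Section FunctorComp.
Variables (C D E : category) (G : functor D E) (F : functor C D).

Let gf_map X Y (u : hom X Y) : hom (G (F X)) (G (F Y)) := fmap G (fmap F u).

Lemma functor_comp_id X : gf_map (idm X) = idm (G (F X)).
Proof. by rewrite /gf_map !fmap_id. Qed.

Lemma functor_comp_comp X Y Z (v : hom Y Z) (u : hom X Y) :
  gf_map (comp v u) = comp (gf_map v) (gf_map u).
Proof. by rewrite /gf_map !fmap_comp. Qed.

Definition functor_comp : functor C E :=
  Functor functor_comp_id functor_comp_comp.
End FunctorComp.

Definition isomorphic_categories (C D : category) : Prop :=
  exists (F : functor C D) (G : functor D C),
    functor_comp G F = functor_id C /\ functor_comp F G = functor_id D.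

(* The base is a parameter rather than a field, so that "having the same base"
   is a typing condition; the triples (I, A, (A_i)) are {I : finType & psite I}. *)
Record psite (I : finType) := PSite {
  ground : Type;
  part : I -> set ground }.

Arguments part {I} p i.

Definition is_bmap (I J : finType) (a : psite I) (b : psite J)
    (phi : I -> J) (f : ground a -> ground b) : Prop :=
  forall j : J, \bigcup_(i in phi @^-1` [set j]) part a i = f @^-1` part b j.

Definition is_bgmap (I : finType) (a b : psite I) (f : ground a -> ground b) :
    Prop :=
  forall i, part a i = f @^-1` part b i.

Definition bpol (I J : finType) (a : psite I) (b : psite J) : set (I -> J) :=
  [set phi | exists f : ground a -> ground b, is_bmap phi f].

Definition simB (I : finType) (a a' : psite I) : Prop :=
  (exists f : ground a -> ground a', is_bgmap f) /\
  (exists f : ground a' -> ground a, is_bgmap f).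

Lemma simB_refl I (a : psite I) : simB a a.
Proof. by split; exists id. Qed.

Lemma simB_sym I (a b : psite I) : simB a b -> simB b a.
Proof. by case. Qed.

Lemma bgmap_comp I (a b c : psite I) (f : ground a -> ground b)
    (g : ground b -> ground c) :
  is_bgmap f -> is_bgmap g -> is_bgmap (g \o f).
Proof. by move=> fP gP i; rewrite fP gP. Qed.

Lemma simB_trans I (a b c : psite I) : simB a b -> simB b c -> simB a c.
Proof.
move=> [[f fP] [f' f'P]] [[g gP] [g' g'P]].
by split; [exists (g \o f) | exists (f' \o g')]; apply: bgmap_comp.
Qed.

Lemma bmap_comp (I J K : finType) (a : psite I) (b : psite J) (c : psite K)
    (phi : I -> J) (psi : J -> K)
    (f : ground a -> ground b) (g : ground b -> ground c) :
  is_bmap phi f -> is_bmap psi g -> is_bmap (psi \o phi) (g \o f).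
Proof.
move=> fP gP k; rewrite [RHS]comp_preimage -gP preimage_bigcup.
under [RHS]eq_bigcupr do rewrite -fP.
apply/seteqP; split=> x [].
  by move=> i /= ik ax; exists (phi i) => //; exists i.
by move=> j /= jk [i /= ij ax]; exists i; rewrite //= ij.
Qed.

Lemma bgmap_bmap (I : finType) (a b : psite I) (f : ground a -> ground b) :
  is_bgmap f -> is_bmap id f.
Proof.
move=> fP i; rewrite -fP; apply/seteqP; split=> [x [_ /= ->] //|x ax].
by exists i.
Qed.

Lemma bpol_comp (I J K : finType) (a : psite I) (b : psite J) (c : psite K)
    (phi : I -> J) (psi : J -> K) :
  bpol a b phi -> bpol b c psi -> bpol a c (psi \o phi).
Proof. by move=> [f fP] [g gP]; exists (g \o f); apply: bmap_comp. Qed.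

Lemma simB_bpol (I : finType) (a b : psite I) : simB a b -> bpol a b id.
Proof. by move=> [[f fP] _]; exists f; apply: bgmap_bmap. Qed.

Lemma bpol_simB (I J : finType) (a a' : psite I) (b b' : psite J) :
  simB a a' -> simB b b' -> bpol a b = bpol a' b'.
Proof.
move=> aa' bb'; apply/seteqP; split=> phi ab.
- exact: bpol_comp (bpol_comp (simB_bpol (simB_sym aa')) ab) (simB_bpol bb').
- exact: bpol_comp (bpol_comp (simB_bpol aa') ab) (simB_bpol (simB_sym bb')).
Qed.

(* A class is a bare predicate because [set (psite I)] would bound the universe
   of the grounds strictly below that of the bases. *)
Record bpol_obj := BPolObj {
  bpol_base : finType;
  bpol_class : psite bpol_base -> Prop;
  bpol_classP : exists a, bpol_class = simB a }.

Arguments bpol_class : clear implicits.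

Definition class_of (I : finType) (a : psite I) : bpol_obj :=
  @BPolObj I (simB a) (ex_intro _ a erefl).

(* [bpol a b] for some representatives, equivalently for all of them. *)
Definition bpol_mor (X Y : bpol_obj) : set (bpol_base X -> bpol_base Y) :=
  [set phi | exists a b, [/\ bpol_class X a, bpol_class Y b & bpol a b phi]].

Arguments bpol_mor : clear implicits.

Lemma bpol_mor_class (I J : finType) (a : psite I) (b : psite J) :
  bpol_mor (class_of a) (class_of b) = bpol a b.
Proof.
apply/seteqP; split=> phi.
  by move=> [a' [b' [aa' bb']]]; rewrite -(bpol_simB aa' bb').
by move=> ab; exists a, b; split=> //; apply: simB_refl.
Qed.

Lemma bpol_mor_id X : bpol_mor X X id.
Proof.
have [a aX] := bpol_classP X; have Xa : bpol_class X a.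
  by rewrite aX; apply: simB_refl.
by exists a, a; split=> //; apply: simB_bpol; apply: simB_refl.
Qed.

Lemma bpol_mor_comp X Y Z psi phi :
  bpol_mor Y Z psi -> bpol_mor X Y phi -> bpol_mor X Z (psi \o phi).
Proof.
move=> [b [c [Yb Zc bc]]] [a [b' [Xa Yb' ab']]].
exists a, c; split=> //; apply: bpol_comp ab' _.
suff b'b : simB b' b by rewrite (bpol_simB b'b (simB_refl c)).
have [d dY] := bpol_classP Y; rewrite dY /= in Yb Yb'.
exact: simB_trans (simB_sym Yb') Yb.
Qed.

Lemma sig_fun_eq (T U : Type) (P : (T -> U) -> Prop) (u v : {f | P f}) :
  sval u = sval v -> u = v.
Proof. exact: eq_sig_hprop (fun _ => @Prop_irrelevance _) u v. Qed.

Definition BPOL : category.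
Proof.
refine (@Category bpol_obj (fun X Y => {phi | bpol_mor X Y phi})
  (fun X => exist _ id (bpol_mor_id X))
  (fun X Y Z v u =>
    exist _ (sval v \o sval u) (bpol_mor_comp (svalP v) (svalP u))) _ _ _).
all: by move=> *; apply: sig_fun_eq.
Defined.

Record p2_obj := P2Obj {
  p2_base : finType;
  p2_sets : {set {set p2_base}} }.

Definition p2_mor (X Y : p2_obj) : set (p2_base X -> p2_base Y) :=
  [set phi | forall s, s \in p2_sets X -> phi @: s \in p2_sets Y].

Arguments p2_mor : clear implicits.

Lemma p2_mor_id X : p2_mor X X id.
Proof. by move=> s Xs; rewrite imset_id. Qed.

Lemma p2_mor_comp X Y Z psi phi :
  p2_mor Y Z psi -> p2_mor X Y phi -> p2_mor X Z (psi \o phi).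
Proof. by move=> psiP phiP s Xs; rewrite imset_comp; apply/psiP/phiP. Qed.

Definition P2 : category.
Proof.
refine (@Category p2_obj (fun X Y => {phi | p2_mor X Y phi})
  (fun X => exist _ id (@p2_mor_id X))
  (fun X Y Z v u =>
    exist _ (sval v \o sval u) (@p2_mor_comp X Y Z _ _ (svalP v) (svalP u))) _ _ _).
all: by move=> *; apply: sig_fun_eq.
Defined.

(* Main.v *)
(* Up to [simB], a p-site is determined by the set of the traces
   [{i | x \in A_i}] of its points: by choice, [phi] underlies a B-map from [a]
   to [b] exactly when the image under [phi] of every trace of [a] is a trace of
   [b]. Every set of subsets of [I] is the set of traces of the p-site whose
   points are its own members, so taking traces is bijective on objects and the
   identity on the underlying functions of morphisms. *)
From mathcomp Require Import all_boot all_classical.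
Require Import Defs.

Set Implicit Arguments.
Unset Strict Implicit.
Unset Printing Implicit Defensive.

Local Open Scope classical_set_scope.

(* Morphisms with propositionally equal ends are compared in the total space,
   which avoids transports. *)
Lemma functor_eq_id (C : category) (F : functor C C) :
    (forall X, F X = X) ->
    (forall X Y (u : hom X Y),
      existT (fun p : C * C => hom p.1 p.2) (F X, F Y) (fmap F u) =
      existT (fun p : C * C => hom p.1 p.2) (X, Y) u) ->
  F = functor_id C.
Proof.
case: F => f m mid mcomp /= /funext fE; move: f fE m mid mcomp => _ -> m.
move=> mid mcomp mE; have {}mE : m = fun _ _ u => u.
  apply: functional_extensionality_dep => X.
  apply: functional_extensionality_dep => Y; apply/funext => u.
  (* Now that the object map is the identity, [e] equates a pair with itself; by proof irrelevance
     it is [erefl], so the transport along it vanishes. *)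
  have := projT2_eq (mE X Y u); set e := projT1_eq _.
  by rewrite /= (Prop_irrelevance e erefl).
move: mid mcomp; rewrite mE => mid mcomp.
by congr Functor; apply: Prop_irrelevance.
Qed.

Section Traces.
Variable I : finType.
Implicit Types a b : psite I.

Definition trace a (x : ground a) : {set I} := finset (fun i => `[< part a i x >]).

Lemma in_trace a x i : (i \in trace (a := a) x) = `[< part a i x >].
Proof. by rewrite inE. Qed.

Definition traces a : {set {set I}} :=
  finset (fun s => `[< exists x : ground a, trace x = s >]).

Lemma tracesP a s : reflect (exists x : ground a, trace x = s) (s \in traces a).
Proof. by rewrite inE; apply: asboolP. Qed.

Definition psite_of_sets (S : {set {set I}}) : psite I :=
  @PSite I {s : {set I} | s \in S} (fun i s => i \in sval s).

Lemma traces_psite_of_sets S : traces (psite_of_sets S) = S.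
Proof.
have traceE (x : ground (psite_of_sets S)) : trace x = sval x.
  by apply/setP => i; rewrite in_trace asboolb.
apply/setP => s; apply/tracesP/idP => [[x <-]|Ss].
  by rewrite traceE; case: x.
by exists (exist _ s Ss); rewrite traceE.
Qed.

End Traces.

(** A point [x] lies in the union over the fibre of [j] exactly when [j] is in the image of its
    trace, so the B-map condition can be read point by point. *)
Lemma is_bmap_trace (I J : finType) (a : psite I) (b : psite J) (phi : I -> J)
    (f : ground a -> ground b) :
  is_bmap phi f <-> forall x, phi @: trace x = trace (f x).
Proof.
have unionE x j :
    (\bigcup_(i in phi @^-1` [set j]) part a i) x <-> j \in phi @: trace x.
  split=> [[i /= <- aix]|/imsetP[i]]; first by rewrite imset_f ?in_trace ?asboolT.
  by rewrite in_trace => /asboolP aix ->; exists i.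
split=> [fP x|fP j].
  apply/setP => j; rewrite in_trace; apply/idP/asboolP.
    by move/unionE; rewrite fP.
  by move=> bj; apply/unionE; rewrite fP.
apply/seteqP; split=> x.
  by move/unionE; rewrite fP in_trace => /asboolP.
by move=> bj; apply/unionE; rewrite fP in_trace; apply/asboolP.
Qed.

Lemma bpol_traces (I J : finType) (a : psite I) (b : psite J) (phi : I -> J) :
  bpol a b phi <-> forall s, s \in traces a -> phi @: s \in traces b.
Proof.
split=> [[f /is_bmap_trace fP] _ /tracesP[x <-]|phiP].
  by apply/tracesP; exists (f x).
have /choice[f fP] (x : ground a) : exists y : ground b, phi @: trace x = trace y.
  have /phiP/tracesP[y yP] : trace x \in traces a by apply/tracesP; exists x.
  by exists y.
by exists f; apply/is_bmap_trace.
Qed.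

Lemma bmap_id_bgmap (I : finType) (a b : psite I) (f : ground a -> ground b) :
  is_bmap id f -> is_bgmap f.
Proof.
move=> fP i; rewrite -fP; apply/seteqP; split=> [x ax|x [_ /= ->] //].
by exists i.
Qed.

(** A B-map over the identity is a BG-map, so BG-maps from [a] to [b] exist exactly when the traces
    of [a] are among those of [b]; the two directions give two inclusions. *)
Lemma simB_traces (I : finType) (a b : psite I) :
  simB a b <-> traces a = traces b.
Proof.
have bpol_id (c d : psite I) : bpol c d id <-> traces c \subset traces d.
  rewrite bpol_traces; split=> [cd|/fintype.subsetP cd s /cd].
    by apply/fintype.subsetP => s /cd; rewrite imset_id.
  by rewrite imset_id.
split=> [ab|ab].
  apply/eqP; rewrite finset.eqEsubset.
  by apply/andP; split; apply/bpol_id; apply: simB_bpol => //; apply: simB_sym.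
have /bpol_id[f fP] : traces a \subset traces b by rewrite ab.
have /bpol_id[g gP] : traces b \subset traces a by rewrite ab.
by split; [exists f | exists g]; apply: bmap_id_bgmap.
Qed.

Lemma bpol_obj_class_of (X : bpol_obj) :
  exists a : psite (bpol_base X), X = class_of a.
Proof. by case: X => I c [a ca] /=; exists a; subst c. Qed.

(** Quantifying over representatives avoids choosing one; all of them have the same traces. *)
Definition class_traces (X : bpol_obj) : {set {set bpol_base X}} :=
  finset (fun s => `[< exists2 a, bpol_class X a & s \in traces a >]).

Lemma class_tracesE (I : finType) (a : psite I) :
  class_traces (class_of a) = traces a.
Proof.
apply/setP => s; rewrite inE; apply/asboolP/idP => [[b /simB_traces -> //]|sa].
by exists a => //; apply: simB_refl.
Qed.

(** Both categories thus have the same functions as morphisms, which lets the functors below keep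
    the underlying functions. *)
Lemma bpol_mor_traces (X Y : bpol_obj) (phi : bpol_base X -> bpol_base Y) :
  bpol_mor X Y phi <-> p2_mor (P2Obj (class_traces X)) (P2Obj (class_traces Y)) phi.
Proof.
have [a Xa] := bpol_obj_class_of X; have [b Yb] := bpol_obj_class_of Y.
move: phi; rewrite Xa Yb => phi.
by rewrite bpol_mor_class bpol_traces /p2_mor /= !class_tracesE.
Qed.

Definition traces_functor : functor BPOL P2.
Proof.
refine (@Functor BPOL P2 (fun X => P2Obj (class_traces X))
  (fun X Y u => exist _ (sval u) (proj1 (bpol_mor_traces _) (svalP u))) _ _).
all: by move=> *; apply: sig_fun_eq.
Defined.

Definition class_of_sets (X : p2_obj) : bpol_obj :=
  class_of (psite_of_sets (p2_sets X)).

Lemma p2_mor_class_of_sets (X Y : p2_obj) (phi : p2_base X -> p2_base Y) :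
  p2_mor X Y phi -> bpol_mor (class_of_sets X) (class_of_sets Y) phi.
Proof. by rewrite bpol_mor_class bpol_traces !traces_psite_of_sets. Qed.

Definition sets_functor : functor P2 BPOL.
Proof.
refine (@Functor P2 BPOL class_of_sets
  (fun X Y u => exist _ (sval u) (p2_mor_class_of_sets (svalP u))) _ _).
all: by move=> *; apply: sig_fun_eq.
Defined.

(** A representative and the p-site built from its traces have equal traces, hence the same
    class. *)
Lemma class_of_traces (X : bpol_obj) :
  simB (psite_of_sets (class_traces X)) = bpol_class X.
Proof.
have [a ->] := bpol_obj_class_of X; rewrite class_tracesE /=.
by apply/funext => b; apply/propext; rewrite !simB_traces traces_psite_of_sets.
Qed.

Lemma class_traces_of_sets (X : p2_obj) :
  class_traces (class_of_sets X) = p2_sets X.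
Proof. by rewrite class_tracesE traces_psite_of_sets. Qed.

(** The bases and [phi] are shared, so once the classes are identified only proofs can differ. *)
Lemma bpol_hom_eq (I J : finType) (c c' : psite I -> Prop)
    (d d' : psite J -> Prop) cP c'P dP d'P (phi : I -> J) uP vP :
    c = c' -> d = d' ->
  existT (fun p : BPOL * BPOL => hom p.1 p.2)
    (@BPolObj I c cP, @BPolObj J d dP) (exist _ phi uP) =
  existT (fun p : BPOL * BPOL => hom p.1 p.2)
    (@BPolObj I c' c'P, @BPolObj J d' d'P) (exist _ phi vP).
Proof.
move=> cc' dd'; subst c' d'.
rewrite (Prop_irrelevance c'P cP) (Prop_irrelevance d'P dP) in vP *.
by congr existT; apply: sig_fun_eq.
Qed.

Lemma p2_hom_eq (I J : finType) (S S' : {set {set I}}) (T T' : {set {set J}})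
    (phi : I -> J) uP vP :
    S = S' -> T = T' ->
  existT (fun p : P2 * P2 => hom p.1 p.2) (P2Obj S, P2Obj T) (exist _ phi uP) =
  existT (fun p : P2 * P2 => hom p.1 p.2) (P2Obj S', P2Obj T') (exist _ phi vP).
Proof.
by move=> SS' TT'; subst S' T'; congr existT; apply: sig_fun_eq.
Qed.

Theorem theorem5p2p4 : isomorphic_categories BPOL P2.
Proof.
have sets_tracesE X Y (u : @hom BPOL X Y) :
    existT (fun p : BPOL * BPOL => hom p.1 p.2)
      (sets_functor (traces_functor X), sets_functor (traces_functor Y))
      (fmap sets_functor (fmap traces_functor u)) = existT _ (X, Y) u.
  (* Once the records are opened, the round trip returns the same bases and [phi] by computation;
     only equality of the classes remains. *)
  case: X Y u => [I c cP] [J d dP] [phi phiP].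
  by apply: bpol_hom_eq;
    [exact: (class_of_traces (BPolObj cP)) | exact: (class_of_traces (BPolObj dP))].
have traces_setsE X Y (u : @hom P2 X Y) :
    existT (fun p : P2 * P2 => hom p.1 p.2)
      (traces_functor (sets_functor X), traces_functor (sets_functor Y))
      (fmap traces_functor (fmap sets_functor u)) = existT _ (X, Y) u.
  case: X Y u => [I S] [J T] [phi phiP].
  by apply: p2_hom_eq;
    [exact: (class_traces_of_sets (P2Obj S)) | exact: (class_traces_of_sets (P2Obj T))].
exists traces_functor, sets_functor; split; apply: functor_eq_id => X.
(* Equality of objects is read off the indices in the equation for the identity morphism. *)
- by have /(f_equal (fun t => (projT1 t).1)) := sets_tracesE X X (idm X).
- exact: sets_tracesE.
- by have /(f_equal (fun t => (projT1 t).1)) := traces_setsE X X (idm X).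
- exact: traces_setsE.
Qed.
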